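(* Let $D_1$ be a conformal disk and let $D_2\subseteq D_1$ be a simple subdomain. Let $g:D_1\to E_1$ be a conformal bijection and set $E_2=g(D_2)$. If $\alpha$ is a quadratic differential admissible for $E_1$, all of whose poles lie in $E_2$, then $$m(D_1,D_2,g^*\alpha)=m(E_1,E_2,\alpha).$$
   Context: **Basic notions.** A bordered Riemann surface $R$ has a double $\hat R$, in which its border $\partial R$ is an analytic curve. A conformal disk is a bordered Riemann surface conformally equivalent to $\mathbb{D}=\{|z|<1\}$; its border and double correspond to $\partial\mathbb{D}$ and the Riemann sphere. A quadratic differential is a meromorphic $2$-differential, locally $\alpha=Q(z)\,dz^2$. A smooth curve $\gamma:(a,b)\to R$ is a trajectory of $\alpha$ if $Q(\gamma(t))\gamma'(t)^2<0$ in every local parameter; a smooth curve in $\partial R$ is a trajectory if $\alpha$ extends analytically to a neighbourhood of it in $\hat R$ and the curve is a trajectory there. A continuous curve on a closed or half-open interval is also called a trajectory if its restriction to the open interval is one. $\alpha$ is admissible for $R$ if all but finitely many points of $\partial R$ lie on a trajectory $(a,b)\to\partial R$ of $\alpha$. For a local biholomorphism $f$ the pull-back is locally $f^*(Q(w)dw^2)=Q(f(z))f'(z)^2dz^2$. **Simple domains.** An open connected subset $D$ of a conformal disk $R$ is simple (with respect to $R$) if it is simply connected and there is a quadratic differential on the closure of $D$ in $\hat R$ which is admissible for $D$ and has no poles on $\partial D$. The boundary of $D$ in $\hat R$ is a finite union of analytic arcs. Its vertices are the zeros on $\partial D$ of this differential together with the points which are an endpoint of only a single trajectory arc of $\partial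 D$. **Adapted cover.** A double cover adapted to $\alpha$ is a double-sheeted cover $\pi:\tilde D_1\to D_1$ with a branch point of order two at each odd-order zero and each odd-order pole of $\alpha$ and no other branch points (two disjoint copies of $D_1$ if there are no such points). There is a meromorphic one-form $\beta$ on $\tilde D_1$ with $\beta^2=\pi^*\alpha$. **Harmonic pair.** Let $D_2\subseteq D_1$ be simple and $\alpha$ admissible for $D_1$ with all poles in $D_2$; put $\tilde D_2=\pi^{-1}(D_2)$. Let $x_1$ be a (multi-valued) primitive of $\beta$ and $q_1=\mathrm{Re}(x_1)$, normalized by $q_1=0$ on $\partial\tilde D_1$; it is part of the setting that $q_1$ is single-valued near $\partial\tilde D_1$, near $\partial\tilde D_2$ and on $\tilde D_1\setminus\tilde D_2$, although it may be singular and multi-valued near the poles. Let $u$ be the harmonic function on $\tilde D_2$ with $u=q_1$ on $\partial\tilde D_2$ and let $q_2=q_1-u$. The pair is determined up to a common sign; $\pm(q_1,q_2)$ is the harmonic pair induced by $(D_1,D_2,\alpha)$. If $\tilde D_1$ is disconnected, $x_1$ is chosen so that the values of $q_1$ at the two points of each fibre differ by a sign. **Module.** In a local parameter $z=x+iy$, $\ast dh=h_x\,dy-h_y\,dx$. The module is $$m(D_1,D_2,\alpha)=\int_{\partial\tilde D_2}q_1\ast dq_2 .$$ The integral is the sum over the boundary arcs of $\tilde D_2$ (arcs joining consecutive preimages of vertices of $\partial D_2$), positively oriented with respect to $\tilde D_2$. An arc with $\tilde D_2$ on one side is traversed once; an arc with $\tilde D_2$ on both sides is traversed twice, with opposite orientations,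 each time using the extension of $\ast dq_2$ from the side with respect to which the arc is positively oriented. The value does not depend on the choice of adapted cover. *)

(* Defs.v *)
From HB Require Import structures.
From mathcomp Require Import all_boot all_order all_algebra.
From mathcomp Require Import complex.
From mathcomp Require Import all_classical all_reals all_analysis.

Set Implicit Arguments.
Unset Strict Implicit.
Unset Printing Implicit Defensive.

Import Order.TTheory GRing.Theory Num.Theory.
Import numFieldNormedType.Exports.

Local Open Scope classical_set_scope.
Local Open Scope ring_scope.
Local Open Scope complex_scope.

(* [R[i]] seen through its [numFieldType] structure: this is the form in which
   the library's topology and norm of a [numFieldType] are inferred. *)
Notation cplx R := (Num.NumField.sort (R[i] : numFieldType)).

Section PlanarAnalysis.
Variable R : realType.
Local Notation C := (cplx R).

Definition holomorphic_at (f : C -> C) (z : C) : Prop :=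
  \forall w \near z, derivable f w 1.

(* The equation also holds at [z] itself, so (as [0 ^ n = 0] in MathComp for
   every [n != 0]) meromorphic functions take the value [0] at their poles and
   have no removable singularities. *)
Definition has_order (f : C -> C) (z : C) (n : int) : Prop :=
  exists h : C -> C, [/\ holomorphic_at h z, h z != 0 &
    \forall w \near z, f w = h w * (w - z) ^ n].

Definition meromorphic_at (f : C -> C) (z : C) : Prop :=
  (exists n, has_order f z n) \/ (\forall w \near z, f w = 0).

Definition velocity (c : R -> C) (t : R) : C :=
  derive1 (fun s => complex.Re (c s)) t +i* derive1 (fun s => complex.Im (c s)) t.

Definition smooth_curve (a b : R) (c : R -> C) : Prop :=
  a < b /\ forall (n : nat) (t : R), a < t < b ->
    derivable (derive1n n (fun s => complex.Re (c s))) t 1 /\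
    derivable (derive1n n (fun s => complex.Im (c s))) t 1.

(* Trajectory of [Q(z) dz^2]; in [R[i]], [w < 0] means that [w] is real and
   negative. *)
Definition trajectory (Q : C -> C) (a b : R) (c : R -> C) : Prop :=
  smooth_curve a b c /\
  forall t, a < t < b -> Q (c t) * velocity c t ^+ 2 < 0.

Definition boundary (V : set C) : set C := closure V `\` interior V.

Definition boundary_trajectory (V : set C) (Q : C -> C)
    (a b : R) (c : R -> C) : Prop :=
  (forall t, a < t < b -> boundary V (c t)) /\
  exists (O : set C) (Qext : C -> C),
    [/\ open O, forall t, a < t < b -> O (c t),
        forall z, O z -> holomorphic_at Qext z,
        {in O `&` V, Qext =1 Q} & trajectory Qext a b c].

Definition admissible_in (V : set C) (Q : C -> C) : Prop :=
  exists F : seq C, forall z, boundary V z -> z \notin F ->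
    exists (a b : R) (c : R -> C) (t : R),
      [/\ boundary_trajectory V Q a b c, a < t < b & c t = z].

Definition simply_connected (V : set C) : Prop :=
  V !=set0 /\
  forall l : R -> C,
    {within `[0, 1], continuous l} -> l @` `[0, 1] `<=` V -> l 0 = l 1 ->
    exists H : R * R -> C,
      [/\ {within `[0, 1] `*` `[0, 1], continuous H},
          H @` (`[0, 1] `*` `[0, 1]) `<=` V,
          {in `[0, 1], forall t, H (0, t) = l t},
          {in `[0, 1], forall t, H (1, t) = l 0} &
          {in `[0, 1], forall s, H (s, 0) = l 0 /\ H (s, 1) = l 0}].

(* [V] is a domain in the unit disk; the double of the disk is the Riemann
   sphere, in which the closure of [V] is the closure in the plane. *)
Definition simple_in (V : set C) (P : C -> C) : Prop :=
  [/\ open V, connected V, simply_connected V &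
    [/\ forall z, closure V z -> meromorphic_at P z,
        admissible_in V P &
        forall z n, boundary V z -> has_order P z n -> 0 <= n]].

(* A trajectory arc of the boundary of [V] with endpoint [z]. *)
Definition arc_from (V : set C) (P : C -> C) (z : C) (b : R) (c : R -> C)
    : Prop :=
  [/\ {within `[0, b[, continuous c}, c 0 = z, trajectory P 0 b c &
      forall t, 0 < t < b -> boundary V (c t)].

(* Two arcs from [z] count as the same one when they overlap near [z]. *)
Definition single_end (V : set C) (P : C -> C) (z : C) : Prop :=
  (exists b c, arc_from V P z b c) /\
  forall b1 c1 b2 c2, arc_from V P z b1 c1 -> arc_from V P z b2 c2 ->
    exists2 e : R, 0 < e <= b1 &
      forall t, 0 <= t < e -> exists2 s, 0 <= s < b2 & c1 t = c2 s.

Definition vertex (V : set C) (P : C -> C) (z : C) : Prop :=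
  boundary V z /\
  ((exists2 n, 0 < n & has_order P z n) \/ single_end V P z).

Definition lies_left (N : set C) (a b : R) (c : R -> C) : Prop :=
  forall t0, a < t0 < b -> exists2 e : R, 0 < e &
    forall t s : R, `|t - t0| < e -> 0 < s < e ->
      N (c t + 'i * s%:C * velocity c t).

Record plane_arc := PlaneArc { arc_start : R; arc_end : R; arc_fun :> R -> C }.

Definition in_arc (g : plane_arc) (t : R) : Prop := arc_start g < t < arc_end g.

(* A piece of the boundary positively oriented with respect to [V], i.e. with
   [V] on its left. *)
Definition oriented_arc (V : set C) (P : C -> C) (S : seq C) (g : plane_arc)
    : Prop :=
  [/\ trajectory P (arc_start g) (arc_end g) g,
      forall t, in_arc g t -> boundary V (g t) /\ g t \notin S &
      lies_left V (arc_start g) (arc_end g) g].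

(* The positively oriented arcs of the boundary of [V], cut at the points of
   [S]. Every oriented boundary arc is covered exactly once, so an arc with [V]
   on both sides occurs in both directions. *)
Definition boundary_arcs (V : set C) (P : C -> C) (S : seq C)
    (n : nat) (g : 'I_n -> plane_arc) : Prop :=
  (forall i, oriented_arc V P S (g i)) /\
  forall d : plane_arc, oriented_arc V P S d -> forall t, in_arc d t ->
    exists! p : 'I_n * R,
      [/\ in_arc (g p.1) p.2, g p.1 p.2 = d t &
          exists2 k : R, 0 < k & velocity (g p.1) p.2 = k%:C * velocity d t].

Definition dX (h : C -> R) (z : C) : R := derive1 (fun t : R => h (z + t%:C)) 0.
Definition dY (h : C -> R) (z : C) : R :=
  derive1 (fun t : R => h (z + 'i * t%:C)) 0.

Definition C1_on (O : set C) (h : C -> R) : Prop :=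
  forall z, O z ->
    [/\ derivable (fun t : R => h (z + t%:C)) 0 1,
        derivable (fun t : R => h (z + 'i * t%:C)) 0 1,
        {for z, continuous (dX h)} & {for z, continuous (dY h)}].

Definition harmonic_on (O : set C) (h : C -> R) : Prop :=
  [/\ C1_on O h, C1_on O (dX h), C1_on O (dY h) &
      forall z, O z -> dX (dX h) z + dY (dY h) z = 0].

(* [I] is the integral of [h1 *dh2 = h1 (h2_x dy - h2_y dx)] along [g], where
   [h1], [h2_x] and [h2_y] are extended from [N] to the arc. *)
Definition arc_integral (N : set C) (h1 h2 : C -> R) (g : plane_arc) (I : R)
    : Prop :=
  exists f A B : R -> R,
    (forall t, in_arc g t ->
      [/\ h1 z @[z --> within N (nbhs (g t))] --> f t,
          dX h2 z @[z --> within N (nbhs (g t))] --> A t &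
          dY h2 z @[z --> within N (nbhs (g t))] --> B t]) /\
    let F t := f t * (A t * complex.Im (velocity g t)
                      - B t * complex.Re (velocity g t)) in
    lebesgue_measure.-integrable `]arc_start g, arc_end g[ (EFin \o F) /\
    I = \int[lebesgue_measure]_(t in `]arc_start g, arc_end g[) F t.

End PlanarAnalysis.

Section RiemannSurfaces.
Variable R : realType.
Local Notation C := (cplx R).

Record chart (T : topologicalType) := Chart {
  cdom : set T;
  cmap :> T -> C;
  cinv : C -> T }.

Definition cimg (T : topologicalType) (c : chart T) : set C := c @` cdom c.

Definition is_chart (T : topologicalType) (c : chart T) : Prop :=
  [/\ open (cdom c), open (cimg c), {in cdom c, cancel c (cinv c)},
      {in cdom c, continuous c} & {in cimg c, continuous (cinv c)}].

Definition compatible (T : topologicalType) (c d : chart T) : Prop :=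
  forall x, cdom c x -> cdom d x -> holomorphic_at (d \o cinv c) (c x).

(* Not assumed connected: an adapted cover may have two components. *)
Record riemannSurface := RiemannSurface {
  rs_space :> topologicalType;
  rs_atlas : set (chart rs_space);
  rs_hausdorff : hausdorff_space rs_space;
  rs_chart : forall c, rs_atlas c -> is_chart c;
  rs_compatible : forall c d, rs_atlas c -> rs_atlas d -> compatible c d;
  rs_cover : forall x : rs_space, exists c, rs_atlas c /\ cdom c x }.

Definition local_param (X : riemannSurface) (c : chart X) : Prop :=
  is_chart c /\
  forall d, rs_atlas d -> compatible c d /\ compatible d c.

Definition chart_at (X : riemannSurface) (x : X) : chart X :=
  projT1 (cid (rs_cover x)).

Definition holomorphic_map (X Y : riemannSurface) (f : X -> Y) : Prop :=
  continuous f /\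
  forall (c : chart X) (d : chart Y) x, rs_atlas c -> rs_atlas d ->
    cdom c x -> cdom d (f x) -> holomorphic_at (d \o f \o cinv c) (c x).

Definition conformal_bijection (X Y : riemannSurface) (f : X -> Y) : Prop :=
  holomorphic_map f /\
  exists h : Y -> X, [/\ cancel f h, cancel h f & holomorphic_map h].

(* A conformal equivalence of [X] with the unit disk, as a global parameter. *)
Definition disk_param (X : riemannSurface) (c : chart X) : Prop :=
  [/\ local_param c, cdom c = setT & cimg c = [set z | `|z| < 1]].

Definition conformal_disk (X : riemannSurface) : Prop :=
  exists c : chart X, disk_param c.

(* A differential [a c z dz^k] in every local parameter [c]. *)
Definition diff_form (X : riemannSurface) := chart X -> C -> C.

Definition meromorphic_differential (k : nat) (X : riemannSurface)
    (a : diff_form X) : Prop :=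
  (forall c z, local_param c -> cimg c z -> meromorphic_at (a c) z) /\
  forall c d x, local_param c -> local_param d -> cdom c x -> cdom d x ->
    a c (c x) = a d (d x) * derive1 (d \o cinv c) (c x) ^+ k.

Definition quadratic_differential (X : riemannSurface) (a : diff_form X)
    : Prop :=
  meromorphic_differential 2 a.

Definition pullback (X Y : riemannSurface) (f : X -> Y) (a : diff_form Y)
    : diff_form X :=
  fun c z => let d := chart_at (f (cinv c z)) in
    a d (d (f (cinv c z))) * derive1 (d \o f \o cinv c) z ^+ 2.

Definition order_at (X : riemannSurface) (a : diff_form X) (x : X) (n : int)
    : Prop :=
  exists c : chart X, [/\ local_param c, cdom c x & has_order (a c) (c x) n].

Definition is_pole (X : riemannSurface) (a : diff_form X) (x : X) : Prop :=
  exists2 n, n < 0 & order_at a x n.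

Definition odd_point (X : riemannSurface) (a : diff_form X) (x : X) : Prop :=
  exists2 n : int, odd `|n|%N & order_at a x n.

(* The border and the double of a conformal disk are the unit circle and the
   Riemann sphere, transported by a conformal equivalence with the unit disk. *)
Definition admissible (X : riemannSurface) (a : diff_form X) : Prop :=
  exists c : chart X, disk_param c /\ admissible_in (cimg c) (a c).

Definition simple_domain (X : riemannSurface) (D : set X) : Prop :=
  exists (c : chart X) (P : C -> C), disk_param c /\ simple_in (c @` D) P.

End RiemannSurfaces.

Section HarmonicPairs.
Variable R : realType.
Local Notation C := (cplx R).
Implicit Types X Y : riemannSurface R.

Definition evenly_two_sheeted X Y (p : X -> Y) (y : Y) : Prop :=
  exists (U : set Y) (U1 U2 : set X),
    [/\ open U /\ U y, open U1 /\ open U2, U1 `&` U2 = set0,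
        p @^-1` U = U1 `|` U2 &
        set_bij U1 U p /\ set_bij U2 U p].

(* Over a neighbourhood of [y], [p] is [z |-> z ^+ 2] in suitable parameters. *)
Definition branched_order_two X Y (p : X -> Y) (y : Y) : Prop :=
  exists (c : chart R X) (d : chart R Y),
    [/\ local_param c /\ local_param d,
        cdom d y /\ d y = 0,
        cdom c = p @^-1` cdom d,
        forall z, cimg c z <-> cimg d (z ^+ 2) &
        forall x, cdom c x -> d (p x) = c x ^+ 2].

Definition adapted_cover X Y (p : X -> Y) (a : diff_form Y) : Prop :=
  [/\ holomorphic_map p,
      forall y, odd_point a y -> branched_order_two p y &
      forall y, ~ odd_point a y -> evenly_two_sheeted p y].

(* Away from the branch points; there the equality of meromorphic differentials
   extends by continuity, but the conventional values at poles need not agree. *)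
Definition square_root_of_pullback X Y (p : X -> Y) (a : diff_form Y)
    (b : diff_form X) : Prop :=
  meromorphic_differential 1 b /\
  forall c x, local_param c -> cdom c x -> ~ odd_point a (p x) ->
    b c (c x) ^+ 2 = pullback p a c (c x).

(* [q] is, near every point of [W], the real part of a primitive of [b]. *)
Definition re_primitive_on X (W : set X) (b : diff_form X) (q : X -> R)
    : Prop :=
  forall c x, local_param c -> W x -> cdom c x ->
    exists F : C -> C,
      \forall z \near c x, is_derive z (1 : C) F (b c z) /\
                           q (cinv c z) = complex.Re (F z).

Definition harmonic_on_surface X (O : set X) (u : X -> R) : Prop :=
  forall c : chart R X, local_param c ->
    harmonic_on (c @` (cdom c `&` O)) (u \o cinv c).

(* [h] vanishes on the border of [p @^-1` D]. The border of [D] is taken in the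
   double, so points of [D] approach it when they leave every compact subset. *)
Definition vanishes_at_border X Y (p : X -> Y) (D : set Y) (h : X -> R)
    : Prop :=
  forall e : R, 0 < e -> exists2 K : set Y, compact K /\ K `<=` D &
    forall x, D (p x) -> ~ K (p x) -> `|h x| < e.

(* A branch of [q1] that is single-valued off the preimage of a compact subset
   [K] of [D2], that is near the borders of both covers and on their
   difference. Its values over [K] are irrelevant. The common sign of
   [(q1, q2)] is the sign of [b]. *)
Definition harmonic_pair X Y (D2 : set Y) (a : diff_form Y) (p : X -> Y)
    (q1 q2 : X -> R) : Prop :=
  exists (b : diff_form X) (K : set Y) (u : X -> R),
    [/\ square_root_of_pullback p a b,
        [/\ compact K, K `<=` D2 &
            re_primitive_on (p @^-1` (~` K)) b q1],
        vanishes_at_border p setT q1 /\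
        (~ connected [set: X] ->
           forall x x', ~ K (p x) -> p x = p x' -> x <> x' -> q1 x' = - q1 x),
        harmonic_on_surface (p @^-1` D2) u /\
        vanishes_at_border p D2 (fun x => q1 x - u x) &
        forall x, q2 x = q1 x - u x].

(* A continuous lift to the cover of the domain [N] in the disk. *)
Definition lift_on X Y (p : X -> Y) (phi : chart R Y) (N : set C) (s : C -> X)
    : Prop :=
  {within N, continuous s} /\ forall z, N z -> phi (p (s z)) = z.

(* The value of the integral of [q1 *dq2] over the border of [p @^-1` D2].
   Border arcs of the cover are described by a positively oriented boundary arc
   of [phi @` D2] and one of the two lifts of a collar [N] on its left, the
   local parameter being [phi \o p]; this also covers the arcs over the border
   of [Y], which has no points in [Y]. The finite set [S] contains the vertices;
   it may contain more points, because a closed boundary curve without vertices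
   must be cut somewhere. *)
Definition border_integral X Y (D2 : set Y) (p : X -> Y)
    (q1 q2 : X -> R) (v : R) : Prop :=
  exists (phi : chart R Y) (P : C -> C) (S : seq C)
         (n : nat) (g : 'I_n -> plane_arc R) (N : 'I_n -> set C)
         (s : 'I_n -> bool -> C -> X) (I : 'I_n -> bool -> R),
    let V := phi @` D2 in
    [/\ disk_param phi /\ simple_in V P,
        (forall z, vertex V P z -> z \in S) /\ boundary_arcs V P S g,
        forall i, [/\ open (N i), N i `<=` V &
          lies_left (N i) (arc_start (g i)) (arc_end (g i)) (g i)],
        forall i, [/\ forall j, lift_on p phi (N i) (s i j),
          forall z, N i z -> s i true z <> s i false z &
          forall j, arc_integral (N i) (q1 \o s i j) (q2 \o s i j) (g i)
                                 (I i j)] &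
        v = \sum_(i < n) \sum_(j : bool) I i j].

Definition module_value Y (D2 : set Y) (a : diff_form Y) (v : R) : Prop :=
  [/\ conformal_disk Y /\ simple_domain D2,
      [/\ quadratic_differential a, admissible a &
          forall y, is_pole a y -> D2 y] &
      exists (X : riemannSurface R) (p : X -> Y) (q1 q2 : X -> R),
        [/\ adapted_cover p a, harmonic_pair D2 a p q1 q2 &
            border_integral D2 p q1 q2 v]].

(* [m(Y, D2, a)] *)
Definition module Y (D2 : set Y) (a : diff_form Y) : R :=
  xget 0 [set v | module_value D2 a v].

End HarmonicPairs.

(* Main.v *)
Require Import Defs.
From mathcomp Require Import all_boot all_order all_algebra.
From mathcomp Require Import complex.
From mathcomp Require Import all_classical all_reals all_analysis.

Set Implicit Arguments.
Unset Strict Implicit.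
Unset Printing Implicit Defensive.

Import Order.TTheory GRing.Theory Num.Theory.
Import numFieldNormedType.Exports.

Local Open Scope classical_set_scope.
Local Open Scope ring_scope.

(** A conformal bijection [g : X -> Y] with inverse [h] identifies all the data
    that enter the module.  A local parameter [c] of [X] becomes the local
    parameter [c \o h] of [Y], with the same image in the plane, and two forms on
    [X] and [Y] that correspond to each other have literally the same expression
    in corresponding parameters.  For [g^* alpha] and [alpha] this is
    [same_form_pullback]: in the parameters [c] and [c \o h] the map [g] is the
    identity, so its derivative there is [1].

    Given an adapted cover [p] of [X], the same surface with the projection
    [g \o p] is an adapted cover of [Y].  The one-form on the cover and the pair
    [(q1, q2)] are kept unchanged: composing the projection with [g] does not
    change the pulled-back quadratic differential ([pullback_transport], which
    rests on the chain rule and the transformation law), and compact sets,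
    orders of zeros and poles, and branching are carried over by [g].  Finally,
    the integral over the border is computed in a disk parameter [phi] of [X];
    replacing it by [phi \o h] changes neither the plane domain nor the arcs nor
    the lifts of the collars, so the very same integrals appear on [Y].  This
    gives [module_value_transport]; since the correspondence of the forms is
    symmetric, it applies to [h] as well, and the two surfaces have the same
    values of the module. *)

(** * Derivatives and orders of complex functions *)

(** In contrast to [derive1_comp], this applies to complex derivatives: the
    field need not be real. *)
Lemma derive1_comp_numField (K : numFieldType) (f k : K -> K) (z : K) :
  derivable f z 1 -> derivable k (f z) 1 ->
  derive1 (k \o f) z = derive1 k (f z) * derive1 f z.
Proof.
move=> /derivable1_diffP df /derivable1_diffP dk.
have dkf : differentiable (k \o f) z by exact: differentiable_comp.
rewrite (derive1E' dkf) (diff_comp df dk) [LHS]/comp (diff1E dk) -(derive1E' df).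
by rewrite mulrC.
Qed.

Lemma near_derivable_comp (K : numFieldType) (f k : K -> K) (z : K) :
  (\forall w \near z, derivable f w 1) ->
  (\forall w \near f z, derivable k w 1) ->
  \forall w \near z, derivable (k \o f) w 1.
Proof.
move=> hf hk.
have /derivable1_diffP/differentiable_continuous fz := nbhs_singleton hf.
have hkf : \forall w \near z, derivable k (f w) 1 := fz _ hk.
apply: filterS2 hf hkf => w /derivable1_diffP df /derivable1_diffP dk.
exact/derivable1_diffP/differentiable_comp.
Qed.

Section ComplexDerivative.
Variable R : realType.
Local Notation C := (cplx R).

Lemma near_eq_derive1 (f f' : C -> C) (z : C) :
  (\forall w \near z, f w = f' w) -> derive1 f z = derive1 f' z.
Proof. by move=> ff'; rewrite !derive1E; exact: near_eq_derive. Qed.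

Lemma derive1_near_id (f : C -> C) (z : C) :
  (\forall w \near z, f w = w) -> derive1 f z = 1.
Proof.
by move=> fE; rewrite (@near_eq_derive1 f id z fE) derive1E derive_id.
Qed.

Lemma near_eq_holomorphic_at (f f' : C -> C) (z : C) :
  (\forall w \near z, f w = f' w) -> holomorphic_at f z -> holomorphic_at f' z.
Proof.
move=> /near_join ff'; apply: filterS2 ff' => w.
exact: near_eq_derivable.
Qed.

Lemma holomorphic_at_derivable (f : C -> C) (z : C) :
  holomorphic_at f z -> derivable f z 1.
Proof. exact: nbhs_singleton. Qed.

Lemma holomorphic_at_comp (f k : C -> C) (z : C) :
  holomorphic_at f z -> holomorphic_at k (f z) -> holomorphic_at (k \o f) z.
Proof. exact: near_derivable_comp. Qed.

Lemma near_eq_has_order (f f' : C -> C) (z : C) (n : int) :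
  (\forall w \near z, f w = f' w) -> has_order f z n -> has_order f' z n.
Proof.
move=> ff' [k [hk kz fk]]; exists k; split=> //.
by apply: filterS2 ff' fk => w <-.
Qed.

Lemma near_eq_meromorphic_at (f f' : C -> C) (z : C) :
  (\forall w \near z, f w = f' w) -> meromorphic_at f z -> meromorphic_at f' z.
Proof.
move=> ff' [[n fn]|f0]; [left|right].
  by exists n; exact: near_eq_has_order fn.
by apply: filterS2 ff' f0 => w <-.
Qed.

Lemma eq_admissible_in (V : set C) (Q Q' : C -> C) :
  {in V, Q =1 Q'} -> admissible_in V Q -> admissible_in V Q'.
Proof.
move=> QQ' [F admF]; exists F => z Vz zF.
have [a [b [c [t [[bc ext] tab ctz]]]]] := admF z Vz zF.
have [U [Qext [oU Uc holQ eqQ tr]]] := ext.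
exists a, b, c, t; split=> //; split=> //.
exists U, Qext; split=> // w; rewrite inE => -[Uw Vw].
by rewrite eqQ ?inE// QQ' ?inE.
Qed.

End ComplexDerivative.

(** * Local parameters and holomorphic maps *)

Section LocalParameters.
Variable R : realType.
Implicit Types X Y : riemannSurface R.

Lemma atlas_local_param X (c : chart R X) : rs_atlas c -> local_param c.
Proof.
move=> ac; split; first exact: rs_chart.
by move=> d ad; split; exact: rs_compatible.
Qed.

Lemma chart_at_local_param X (x : X) : local_param (chart_at x).
Proof. by apply: atlas_local_param; rewrite /chart_at; case: cid => ? []. Qed.

Lemma cdom_chart_at X (x : X) : cdom (chart_at x) x.
Proof. by rewrite /chart_at; case: cid => ? []. Qed.

Lemma near_cdom X (c : chart R X) x : local_param c -> cdom c x ->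
  \forall y \near x, cdom c y.
Proof. by move=> [[oc _ _ _ _] _] cx; exact: open_nbhs_nbhs. Qed.

Lemma near_cimg X (c : chart R X) z : local_param c -> cimg c z ->
  \forall w \near z, cimg c w.
Proof. by move=> [[_ oc _ _ _] _] cx; exact: open_nbhs_nbhs. Qed.

Lemma cimg_cdom X (c : chart R X) x : cdom c x -> cimg c (c x).
Proof. by move=> cx; exists x. Qed.

Lemma local_paramK X (c : chart R X) x : local_param c -> cdom c x ->
  cinv c (c x) = x.
Proof. by move=> [[_ _ cK _ _] _] cx; rewrite cK ?inE. Qed.

Lemma local_paramVK X (c : chart R X) z : local_param c -> cimg c z ->
  c (cinv c z) = z.
Proof. by move=> lc [x cx <-]; rewrite local_paramK. Qed.

Lemma continuous_cinv X (c : chart R X) z : local_param c -> cimg c z ->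
  {for z, continuous (cinv c)}.
Proof. by move=> [[_ _ _ _ cc] _] cz; apply: cc; rewrite inE. Qed.

Lemma continuous_chart X (c : chart R X) x : local_param c -> cdom c x ->
  {for x, continuous c}.
Proof. by move=> [[_ _ _ cc _] _] cz; apply: cc; rewrite inE. Qed.

Lemma near_cinv X (c : chart R X) x (P : set X) : local_param c -> cdom c x ->
  (\forall y \near x, P y) -> \forall w \near c x, P (cinv c w).
Proof.
move=> lc cx Px.
apply: (continuous_cinv lc (cimg_cdom cx)).
by rewrite /= local_paramK.
Qed.

(** Holomorphy of a map is defined through the atlases only; it extends to
    arbitrary local parameters because these are compatible with the atlases, so
    [d \o f \o cinv c] factors through atlas charts near [c x]. *)
Lemma holomorphic_map_local_param X Y (f : X -> Y) (c : chart R X)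
    (d : chart R Y) (x : X) : holomorphic_map f ->
  local_param c -> local_param d -> cdom c x -> cdom d (f x) ->
  holomorphic_at (d \o f \o cinv c) (c x).
Proof.
move=> [cf hf] lc ld cx dfx.
have [c0 [ac0 c0x]] := rs_cover x; have [d0 [ad0 d0x]] := rs_cover (f x).
have lc0 := atlas_local_param ac0; have ld0 := atlas_local_param ad0.
pose k := ((d \o cinv d0) \o (d0 \o f \o cinv c0)) \o (c0 \o cinv c).
apply: (@near_eq_holomorphic_at _ k).
  have : \forall y \near x, cdom c0 y /\ cdom d0 (f y).
    by apply: filterI; [exact: near_cdom | apply: cf; exact: near_cdom].
  move=> /(near_cinv lc cx); apply: filterS => w [c0w d0w].
  by rewrite /k /= !local_paramK.
apply: holomorphic_at_comp; first exact: (lc.2 _ ac0).1.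
rewrite /= (local_paramK lc)//.
apply: holomorphic_at_comp; first exact: hf.
by rewrite /= (local_paramK lc0)//; exact: (ld.2 _ ad0).2.
Qed.

Lemma holomorphic_map_comp X Y (Z : riemannSurface R) (f : X -> Y)
    (k : Y -> Z) :
  holomorphic_map f -> holomorphic_map k -> holomorphic_map (k \o f).
Proof.
move=> hf hk; have [cf _] := hf; have [ck _] := hk; split.
  by move=> x; apply: continuous_comp; [exact: cf | exact: ck].
move=> c d x /atlas_local_param lc /atlas_local_param ld cx dx.
have le := chart_at_local_param (f x); set e := chart_at (f x) in le.
have ex : cdom e (f x) := cdom_chart_at _.
apply: (@near_eq_holomorphic_at _ ((d \o k \o cinv e) \o (e \o f \o cinv c))).
  have : \forall y \near x, cdom e (f y) by apply: cf; exact: near_cdom.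
  by move=> /(near_cinv lc cx); apply: filterS => w ew; rewrite /= local_paramK.
apply: holomorphic_at_comp; first exact: holomorphic_map_local_param.
rewrite /= (local_paramK lc)//.
exact: holomorphic_map_local_param.
Qed.

(** The pull-back is defined with a chosen chart of the target at each point.
    The transformation law of [a] and the chain rule show that any other local
    parameter of the target gives the same value. *)
Lemma pullback_local_param X Y (f : X -> Y) (a : diff_form Y) (c : chart R X)
    (d : chart R Y) (x : X) : quadratic_differential a -> holomorphic_map f ->
  local_param c -> local_param d -> cdom c x -> cdom d (f x) ->
  pullback f a c (c x) = a d (d (f x)) * derive1 (d \o f \o cinv c) (c x) ^+ 2.
Proof.
move=> [_ trans] hf lc ld cx dfx.
rewrite /pullback (local_paramK lc cx).
have le := chart_at_local_param (f x); set e := chart_at (f x) in le *.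
have efx : cdom e (f x) := cdom_chart_at _.
rewrite (trans e d (f x) le ld efx dfx) -mulrA -exprMn; congr (_ * _ ^+ 2).
(* The transition between two local parameters of [Y] is the identity map read
   in these parameters. *)
have hid : holomorphic_map (@idfun Y).
  split=> [y|c0 d0 y ac0 ad0]; first exact: cvg_id.
  exact: rs_compatible.
have -> : derive1 (d \o f \o cinv c) (c x) =
          derive1 ((d \o cinv e) \o (e \o f \o cinv c)) (c x).
  apply: near_eq_derive1.
  have : \forall y \near x, cdom e (f y) by apply: hf.1; exact: near_cdom.
  by move=> /(near_cinv lc cx); apply: filterS => w ew; rewrite /= local_paramK.
rewrite derive1_comp_numField ?/= ?local_paramK//.
  exact/holomorphic_at_derivable/holomorphic_map_local_param.
apply/holomorphic_at_derivable.
exact: (holomorphic_map_local_param hid).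
Qed.

End LocalParameters.


(** * Transport along a conformal bijection *)

Definition transport_chart (R : realType) (X Y : riemannSurface R)
    (g : X -> Y) (h : Y -> X) (c : chart R X) : chart R Y :=
  Chart (h @^-1` cdom c) (c \o h) (g \o cinv c).

(** For quadratic differentials and a conformal bijection [g] with inverse [h]
    this amounts to [a = g^* a'], but unlike a pull-back it is symmetric in the
    two surfaces and involves no derivative. *)
Definition same_form (R : realType) (X Y : riemannSurface R)
    (g : X -> Y) (h : Y -> X) (a : diff_form X) (a' : diff_form Y) : Prop :=
  forall c z, local_param c -> cimg c z -> a' (transport_chart g h c) z = a c z.

Section Transport.
Variables (R : realType) (X Y : riemannSurface R) (g : X -> Y) (h : Y -> X).
Hypotheses (gK : cancel g h) (hK : cancel h g).
Local Notation "c ^g" := (transport_chart g h c) (at level 2, format "c ^g").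

Lemma transport_chartK : cancel (transport_chart g h) (transport_chart h g).
Proof.
case=> D c c'; rewrite /transport_chart /=; congr Chart; apply/funext => x /=.
- by rewrite gK.
- by rewrite gK.
- by rewrite gK.
Qed.

Lemma image_transport_chart (c : chart R X) (D : set X) :
  c^g @` (h @^-1` D) = c @` D.
Proof.
apply/seteqP; split=> z [x Dx <-]; first by exists (h x).
by exists (g x); rewrite /= gK.
Qed.

Lemma cimg_transport_chart (c : chart R X) : cimg c^g = cimg c.
Proof. exact: image_transport_chart. Qed.

Lemma preimage_compK (W : Type) (p : W -> X) (D : set X) :
  (g \o p) @^-1` (h @^-1` D) = p @^-1` D.
Proof. by apply/funext => w; rewrite /preimage /= gK. Qed.

Lemma image_cancel (D : set X) : g @` D = h @^-1` D.
Proof.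
apply/seteqP; split=> [_ [x Dx <-]|y Dy]; first by rewrite /= gK.
by exists (h y).
Qed.

Hypotheses (hol_g : holomorphic_map g) (hol_h : holomorphic_map h).

Lemma local_param_transport (c : chart R X) : local_param c -> local_param c^g.
Proof.
move=> lc; have [[odc oic cK cc cv] _] := lc.
split; last first.
  move=> d ad; have ld := atlas_local_param ad; split=> y cy dy.
    have := holomorphic_map_local_param hol_g lc ld cy.
    by rewrite hK => /(_ dy).
  exact: (holomorphic_map_local_param hol_h ld lc cy dy).
split.
- apply: open_comp odc => z _; exact: hol_h.1.
- by rewrite cimg_transport_chart.
- by move=> y; rewrite inE => cy /=; rewrite (local_paramK lc)// hK.
- move=> y; rewrite inE => cy; apply: continuous_comp; first exact: hol_h.1.
  exact: continuous_chart.
- move=> z; rewrite cimg_transport_chart inE => cz.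
  by apply: continuous_comp; [exact: continuous_cinv | exact: hol_g.1].
Qed.

Lemma disk_param_transport (c : chart R X) : disk_param c -> disk_param c^g.
Proof.
move=> [lc cT ci]; split; first exact: local_param_transport.
  by rewrite /= cT.
by rewrite cimg_transport_chart.
Qed.

Lemma conformal_disk_transport : conformal_disk X -> conformal_disk Y.
Proof. by move=> [c dc]; exists c^g; exact: disk_param_transport. Qed.

Lemma simple_domain_transport (D : set X) :
  simple_domain D -> simple_domain (h @^-1` D).
Proof.
move=> [c [P [dc sP]]]; exists c^g, P; split; first exact: disk_param_transport.
by rewrite image_transport_chart.
Qed.

Lemma compact_transport (K : set X) : compact K -> compact (h @^-1` K).
Proof.
rewrite -image_cancel; apply: continuous_compact.
exact/continuous_subspaceT/hol_g.1.
Qed.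

Lemma vanishes_at_border_transport (W : riemannSurface R) (p : W -> X)
    (D : set X) (q : W -> R) :
  vanishes_at_border p D q -> vanishes_at_border (g \o p) (h @^-1` D) q.
Proof.
move=> qD e e0; have [K [cK KD] Kq] := qD e e0.
exists (h @^-1` K).
  by split; [exact: compact_transport | move=> y; exact: KD].
by move=> w /=; rewrite gK; exact: Kq.
Qed.

Lemma evenly_two_sheeted_transport (W : riemannSurface R) (p : W -> X) (y : Y) :
  evenly_two_sheeted p (h y) -> evenly_two_sheeted (g \o p) y.
Proof.
move=> [U [U1 [U2 [[oU Uy] oU12 U12 pU [bU1 bU2]]]]].
have bij_comp V : set_bij V U p -> set_bij V (h @^-1` U) (g \o p).
  move=> [pV ip sp]; split.
  - by move=> w Vw; rewrite /= gK; exact: pV.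
  - by move=> w w' Vw Vw' /(can_inj gK); exact: ip.
  - by move=> y' /sp[w Vw pw]; exists w => //=; rewrite pw hK.
exists (h @^-1` U), U1, U2; split=> //.
- by split=> //; apply: open_comp oU => z _; exact: hol_h.1.
- by rewrite preimage_compK.
- by split; exact: bij_comp.
Qed.

Lemma branched_order_two_transport (W : riemannSurface R) (p : W -> X) (y : Y) :
  branched_order_two p (h y) -> branched_order_two (g \o p) y.
Proof.
move=> [c [d [[lc ld] dy cd cdz dE]]]; exists c, d^g; split=> //.
- by split=> //; exact: local_param_transport.
- by rewrite cd -(preimage_compK p).
- by rewrite cimg_transport_chart.
- by move=> w cw; rewrite /= gK; exact: dE.
Qed.

(** Read in the disk parameters [phi] and [phi \o h], the domain, its boundary
    arcs and the lifts of their collars are the same, so that no change of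
    variables takes place in the integrals. *)
Lemma border_integral_transport (W : riemannSurface R) (p : W -> X)
    (D : set X) (q1 q2 : W -> R) (v : R) :
  border_integral D p q1 q2 v ->
  border_integral (h @^-1` D) (g \o p) q1 q2 v.
Proof.
move=> [phi [P [S [n [e [N [s [I [[dphi sP] arcs collar lifts vE]]]]]]]]].
exists phi^g, P, S, n, e, N, s, I; rewrite image_transport_chart; split=> //.
  by split=> //; exact: disk_param_transport.
move=> i; have [lift_s s_neq int_s] := lifts i; split=> // j.
have [cs sE] := lift_s j; split=> // z Nz.
by rewrite /= gK sE.
Qed.

Section SameForm.
Variables (a : diff_form X) (a' : diff_form Y).
Hypothesis aa' : same_form g h a a'.

Lemma order_at_transport (x : X) (n : int) :
  order_at a x n -> order_at a' (g x) n.
Proof.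
move=> [c [lc cx an]]; exists c^g; split.
- exact: local_param_transport.
- by rewrite /= gK.
- rewrite /= gK; apply: near_eq_has_order an.
  have := near_cimg lc (cimg_cdom cx); apply: filterS => w cw.
  by rewrite aa'.
Qed.

Lemma admissible_transport : admissible a -> admissible a'.
Proof.
move=> [c [dc adm]]; have [lc _ _] := dc.
exists c^g; split; first exact: disk_param_transport.
rewrite cimg_transport_chart; apply: eq_admissible_in adm => z.
by rewrite inE => cz; rewrite aa'.
Qed.

(** In the parameters [d] of [X] and [d \o h] of [Y] the maps [p] and [g \o p]
    have the same expression, and so have the two forms. *)
Lemma pullback_transport (W : riemannSurface R) (p : W -> X)
    (c : chart R W) (w : W) : holomorphic_map p ->
  quadratic_differential a -> quadratic_differential a' ->
  local_param c -> cdom c w ->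
  pullback (g \o p) a' c (c w) = pullback p a c (c w).
Proof.
move=> hol_p qa qa' lc cw.
have ld := chart_at_local_param (p w); set d := chart_at (p w) in ld.
have dw : cdom d (p w) := cdom_chart_at _.
rewrite (pullback_local_param qa hol_p lc ld cw dw).
have dgw : cdom d^g ((g \o p) w) by rewrite /= gK.
rewrite (pullback_local_param qa' (holomorphic_map_comp hol_p hol_g) lc
  (local_param_transport ld) cw dgw).
rewrite (_ : d^g \o (g \o p) \o cinv c = d \o p \o cinv c); last first.
  by apply/funext => z /=; rewrite gK.
rewrite (_ : d^g ((g \o p) w) = d (p w)); last by rewrite /= gK.
by rewrite aa'//; exact: cimg_cdom.
Qed.

End SameForm.

End Transport.

Section SameFormSymmetric.
Variables (R : realType) (X Y : riemannSurface R) (g : X -> Y) (h : Y -> X).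
Hypotheses (gK : cancel g h) (hK : cancel h g).
Hypotheses (hol_g : holomorphic_map g) (hol_h : holomorphic_map h).
Variables (a : diff_form X) (a' : diff_form Y).

(** In the parameters [c] and [c \o h] the map [g] is the identity of the plane,
    so the factor in the definition of the pull-back is [1]. *)
Lemma same_form_pullback : quadratic_differential a' ->
  same_form g h (pullback g a') a'.
Proof.
move=> qa' c _ lc [x cx <-].
have lgc := local_param_transport gK hK hol_g hol_h lc.
have gcx : cdom (transport_chart g h c) (g x) by rewrite /= gK.
rewrite (pullback_local_param qa' hol_g lc lgc cx gcx).
rewrite derive1_near_id ?expr1n ?mulr1 /= ?gK//.
have := near_cimg lc (cimg_cdom cx); apply: filterS => z cz.
by rewrite /= gK local_paramVK.
Qed.

Hypothesis aa' : same_form g h a a'.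

Lemma same_form_sym : same_form h g a' a.
Proof.
move=> c z lc cz; rewrite -aa'.
- by rewrite (transport_chartK hK).
- exact: local_param_transport.
- by rewrite (cimg_transport_chart hK).
Qed.

Lemma quadratic_differential_transport :
  quadratic_differential a -> quadratic_differential a'.
Proof.
move=> [mer trans]; have a'a := same_form_sym.
have lh (c : chart R Y) : local_param c -> local_param (transport_chart h g c).
  exact: local_param_transport.
split=> [c z lc cz|c d y lc ld cy dy].
  apply: (@near_eq_meromorphic_at _ (a (transport_chart h g c))).
    by have := near_cimg lc cz; apply: filterS => w cw; rewrite a'a.
  by apply: mer; [exact: lh | rewrite (cimg_transport_chart hK)].
have chE (e : chart R Y) : transport_chart h g e (h y) = e y by rewrite /= hK.
have domE (e : chart R Y) : cdom e y -> cdom (transport_chart h g e) (h y).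
  by rewrite /= hK.
have := trans _ _ _ (lh _ lc) (lh _ ld) (domE _ cy) (domE _ dy).
rewrite !chE (a'a _ _ lc (cimg_cdom cy)) (a'a _ _ ld (cimg_cdom dy)) => ->.
suff -> : transport_chart h g d \o cinv (transport_chart h g c) = d \o cinv c.
  by [].
by apply/funext => z /=; rewrite hK.
Qed.

End SameFormSymmetric.

(** * Transport of covers, harmonic pairs and module values *)

Section ModuleTransport.
Variables (R : realType) (X Y : riemannSurface R) (g : X -> Y) (h : Y -> X).
Hypotheses (gK : cancel g h) (hK : cancel h g).
Hypotheses (hol_g : holomorphic_map g) (hol_h : holomorphic_map h).
Variables (a : diff_form X) (a' : diff_form Y).
Hypothesis aa' : same_form g h a a'.
Hypothesis qa : quadratic_differential a.

Let qa' : quadratic_differential a' :=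
  quadratic_differential_transport gK hK hol_g hol_h aa' qa.
Let a'a : same_form h g a' a := same_form_sym gK hK hol_g hol_h aa'.

Lemma order_at_transportE (y : Y) (n : int) :
  order_at a' y n <-> order_at a (h y) n.
Proof.
split=> [|an]; first exact: (order_at_transport hK gK hol_h hol_g a'a).
by rewrite -[y]hK; exact: (order_at_transport gK hK hol_g hol_h aa').
Qed.

Lemma odd_point_transport (y : Y) : odd_point a' y <-> odd_point a (h y).
Proof.
by split=> -[n on an]; exists n => //; apply/order_at_transportE.
Qed.

Lemma adapted_cover_transport (W : riemannSurface R) (p : W -> X) :
  adapted_cover p a -> adapted_cover (g \o p) a'.
Proof.
move=> [hol_p branched even]; split; first exact: holomorphic_map_comp.
  by move=> y /odd_point_transport/branched; exact: branched_order_two_transport.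
move=> y oy; apply: evenly_two_sheeted_transport => //.
by apply: even => /odd_point_transport.
Qed.

Lemma harmonic_pair_transport (W : riemannSurface R) (p : W -> X)
    (D : set X) (q1 q2 : W -> R) : holomorphic_map p ->
  harmonic_pair D a p q1 q2 -> harmonic_pair (h @^-1` D) a' (g \o p) q1 q2.
Proof.
move=> hol_p [b [K [u [[merb sqb] [cK KD primb] [q10 q1N] [hu u0] q2E]]]].
exists b, (h @^-1` K), u; split=> //.
- split=> // c w lc cw ogw.
  rewrite (pullback_transport gK hK hol_g hol_h aa')//.
  by apply: sqb => // /= ow; apply: ogw; apply/odd_point_transport; rewrite /= gK.
- split; first exact: compact_transport.
    by move=> y; exact: KD.
  by rewrite (preimage_compK gK p (~` K)).
- split; first exact: (vanishes_at_border_transport gK hK hol_g (D := setT)).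
  move=> ncW w w' /=; rewrite gK => Kw /(can_inj gK).
  exact: q1N.
- rewrite preimage_compK//; split=> //.
  exact: vanishes_at_border_transport.
Qed.

(** The cover and the harmonic pair that witness a value of the module on [X]
    also witness it on [Y], the projection [p] being replaced by [g \o p]. *)
Lemma module_value_transport (D : set X) (v : R) :
  module_value D a v -> module_value (h @^-1` D) a' v.
Proof.
move=> [[diskX simD] [_ adm poles] [W [p [q1 [q2 [cov pair int]]]]]].
have [hol_p _ _] := cov.
split.
- split; first exact: (conformal_disk_transport gK hK hol_g hol_h).
  exact: simple_domain_transport.
- split=> //; first exact: (admissible_transport gK hK hol_g hol_h aa').
  by move=> y [n n0 an]; apply: poles; exists n => //; apply/order_at_transportE.
- exists W, (g \o p), q1, q2; split.
  + exact: adapted_cover_transport.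
  + exact: harmonic_pair_transport.
  + exact: border_integral_transport.
Qed.

End ModuleTransport.

Theorem theorem3p19 (R : realType) (D1 E1 : riemannSurface R)
    (D2 : set D1) (g : D1 -> E1) (alpha : diff_form E1)
    (disk_D1 : conformal_disk D1)
    (simple_D2 : simple_domain D2)
    (conformal_g : conformal_bijection g)
    (quadratic_alpha : quadratic_differential alpha)
    (admissible_alpha : admissible alpha)
    (poles_alpha : forall y, is_pole alpha y -> (g @` D2) y) :
  (forall v : R,
     module_value D2 (pullback g alpha) v <-> module_value (g @` D2) alpha v) /\
  module D2 (pullback g alpha) = module (g @` D2) alpha.
Proof.
have [hol_g [h [gK hK hol_h]]] := conformal_g.
have ga : same_form g h (pullback g alpha) alpha by exact: same_form_pullback.
have ag := same_form_sym gK hK hol_g hol_h ga.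
have values v :
    module_value D2 (pullback g alpha) v <-> module_value (g @` D2) alpha v.
  rewrite (image_cancel gK hK); split=> [mv|].
    apply: (module_value_transport gK hK hol_g hol_h ga) mv.
    exact: (quadratic_differential_transport hK gK hol_h hol_g ag).
  (* For the converse, [D2] is the preimage under [g] of its image. *)
  rewrite -[D2 in X in _ -> X](preimage_compK gK id).
  exact: (module_value_transport hK gK hol_h hol_g ag).
split; first exact: values.
by congr (xget 0 _); apply/funext => v; apply: propext; exact: values.
Qed.
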